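(* Let $\Bbbk$ be a field and let $n\ge 1$. For the Lie algebra $\mathfrak{sl}_{n+1}$ over $\Bbbk$, the following equality of ideals in the polynomial ring $\Bbbk[\mathbf{u}]=\Bbbk[u_{ij}\mid 1\le i<j\le n+1]$ holds: $$I_{\Delta(\mathfrak{sl}_{n+1})} = \mathcal{I}_{\mathcal{B}}.$$
   Context: The ideal $\mathcal{I}_{\mathcal{B}}$: let $\mathbb{T}$ be the diagonal torus, and let $\mathbb{U}$ and $\mathbb{L}$ be the upper and lower triangular unipotent subgroups of $SL_{n+1}$. Write $\mathfrak{sl}_{n+1}=\mathfrak{l}\oplus\mathfrak{h}\oplus\mathfrak{u}$, with $\mathfrak{l}$, $\mathfrak{h}$, $\mathfrak{u}$ the strictly lower triangular, diagonal traceless, and strictly upper triangular matrices. Let $\mathbf{u}=(u_{ij})$ also denote the strictly upper triangular $(n+1)\times(n+1)$ matrix of variables; identify $\mathrm{Spec}\,\Bbbk[\mathbf{u}]$ with $\mathbb{U}$ via $\mathbf{u}\mapsto I+\mathbf{u}$. Let $\varphi\colon\mathbb{U}\to\underline{\mathsf{Hom}}(\mathfrak{l},\mathfrak{h})$ (the affine space of linear maps $\mathfrak{l}\to\mathfrak{h}$) be $\varphi_u(C)=\mathrm{proj}_{\mathfrak{h}}(\mathrm{Ad}_u(C))$, where $\mathrm{proj}_{\mathfrak{h}}$ is the projection along $\mathfrak{l}\oplus\mathfrak{u}$; let $\mathcal{B}=\varphi^{-1}(D_{\mathfrak{l},\mathfrak{h}})$, where $D_{\mathfrak{l},\mathfrak{h}}$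 is the determinantal subscheme (defined by the $n\times n$ minors) of maps not of maximal rank. Then $\mathcal{I}_{\mathcal{B}}\subset\Bbbk[\mathbf{u}]$ is the ideal of $\mathcal{B}$. Explicitly, with $U=I+\mathbf{u}$ and $V=(I+\mathbf{u})^{-1}$, $\mathcal{I}_{\mathcal{B}}$ is generated by the $n\times n$ minors of the matrix with rows indexed by pairs $(i,j)$, $1\le i<j\le n+1$, columns indexed by $k=1,\dots,n$, and entries $V_{ik}U_{kj}$ (this is the matrix of $\varphi_{I+\mathbf{u}}$ with respect to the basis $\mathbf{e}_{ji}$ of $\mathfrak{l}$ and the basis $\mathbf{e}_{kk}-\mathbf{e}_{n+1,n+1}$ of $\mathfrak{h}$, where $\mathbf{e}_{k\ell}$ denotes the matrix with a 1 in entry $(k,\ell)$ and zeros elsewhere). The ideal $I_{\Delta(\mathfrak{sl}_{n+1})}$: in $\mathfrak{h}_{\mathbb{R}}=\{x\in\mathbb{R}^{n+1}\mid\sum x_i=0\}$ let $\Omega_{ij}=\{x\mid x_i=x_j\}$ for $1\le i<j\le n+1$, and let $\mathscr{A}=\{\Omega_{ij}\}$. Let $L(\mathscr{A})$ be the set of all intersections of members of $\mathscr{A}$ (including the empty intersection $\mathfrak{h}_{\mathbb{R}}$), ordered by reverse inclusion, and let $L(\mathscr{A})^\circ$ be $L(\mathscr{A})$ with its minimal element $\mathfrak{h}_{\mathbb{R}}$ and its maximal element $\bigcap\Omega_{ij}=\{0\}$ removed. The nerve complex $\Delta(\mathfrak{sl}_{n+1})$ is the simplicial complex on the vertex set $\mathscr{A}$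 whose faces are the subsets of the sets $F_\pi=\{\Omega\in\mathscr{A}\mid\Omega\supseteq\pi\}$, $\pi\in L(\mathscr{A})^\circ$ (together with the empty face). The Stanley-Reisner ideal $I_{\Delta(\mathfrak{sl}_{n+1})}\subset\Bbbk[\mathbf{u}]$ is generated by the squarefree monomials $u_{i_1j_1}\cdots u_{i_kj_k}$ such that $\{\Omega_{i_1j_1},\dots,\Omega_{i_kj_k}\}$ is not a face of $\Delta(\mathfrak{sl}_{n+1})$. *)

(* Defs.v *)
From HB Require Import structures.
From mathcomp Require Import all_boot all_order all_algebra.
From mathcomp Require Import mpoly.
From mathcomp Require Import reals.

Set Implicit Arguments.
Unset Strict Implicit.
Unset Printing Implicit Defensive.

Import GRing.Theory.
Local Open Scope ring_scope.

Definition ideal_gen (A : comNzRingType) (S : A -> Prop) (x : A) : Prop :=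
  exists s : seq (A * A),
    (forall p, p \in s -> S p.2) /\ x = \sum_(p <- s) p.1 * p.2.

(* Pairs of indices i < j, numbered from 0 to n. *)
Definition upair (n : nat) : finType :=
  {p : 'I_n.+1 * 'I_n.+1 | (p.1 < p.2)%N}.

Definition fst_ix n (p : upair n) : 'I_n.+1 := (val p).1.
Definition snd_ix n (p : upair n) : 'I_n.+1 := (val p).2.

(* k[u_ij | i < j]; [mpoly] wants variables indexed by an ordinal. *)
Notation polyu K n := {mpoly K[#|upair n|]}.

Definition u_var (K : fieldType) n (p : upair n) : polyu K n :=
  'X_(enum_rank p).

Definition umx (K : fieldType) n : 'M[polyu K n]_n.+1 :=
  \matrix_(i, j) if insub (i, j) is Some p then u_var K p else 0.

(* The universal point I + u of the unipotent group. *)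
Definition Umx (K : fieldType) n : 'M[polyu K n]_n.+1 := 1%:M + umx K n.

(* [invmx] is a junk value on singular matrices, which is not the case here. *)
Lemma Umx_unit (K : fieldType) n : Umx K n \in unitmx.
Proof.
rewrite -unitmx_tr unitmxE det_trig; last first.
  apply/is_trig_mxP => i j ltij.
  rewrite !mxE insubF /=; last by apply/negbTE; rewrite -leqNgt ltnW.
  by rewrite addr0 -val_eqE /= eqn_leq leqNgt ltij.
rewrite big1 ?unitr1 // => i _.
by rewrite !mxE insubF /= ?ltnn // addr0 eqxx.
Qed.

Definition Ad (A : comUnitRingType) n (g C : 'M[A]_n) : 'M[A]_n :=
  g *m C *m invmx g.

(* Projection onto the diagonal matrices along strictly triangular ones. *)
Definition proj_h (A : pzRingType) n (C : 'M[A]_n) : 'M[A]_n :=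
  diag_mx (\row_k C k k).

Definition phi (K : fieldType) n (C : 'M[polyu K n]_n.+1) : 'M[polyu K n]_n.+1 :=
  proj_h (Ad (Umx K n) C).

Definition e_lower (A : pzRingType) n (p : upair n) : 'M[A]_n.+1 :=
  delta_mx (snd_ix p) (fst_ix p).

Definition e_diag (A : pzRingType) n (k : 'I_n) : 'M[A]_n.+1 :=
  delta_mx (lift ord_max k) (lift ord_max k) - delta_mx ord_max ord_max.

Lemma e_diagE (A : pzRingType) n (k : 'I_n) i j :
  e_diag A k i j = ((i == lift ord_max k) && (j == lift ord_max k))%:R
                   - ((i == ord_max) && (j == ord_max))%:R.
Proof. by rewrite !mxE. Qed.

(* Matrix of phi in the bases [e_lower] and [e_diag]: the coordinate along
   [e_diag k] of a traceless diagonal matrix is its k-th diagonal entry. *)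
Definition phi_coef (K : fieldType) n (p : upair n) (k : 'I_n) : polyu K n :=
  phi (e_lower _ p) (lift ord_max k) (lift ord_max k).

Lemma phi_coefE (K : fieldType) n (p : upair n) (k : 'I_n) :
  phi_coef K p k = invmx (Umx K n) (fst_ix p) (lift ord_max k)
                   * Umx K n (lift ord_max k) (snd_ix p).
Proof.
rewrite /phi_coef /phi /proj_h 2!mxE eqxx mulr1n mxE (bigD1 (fst_ix p)) //=.
rewrite big1 ?addr0 => [|i nei]; last first.
  rewrite mxE big1 ?mul0r // => j _.
  by rewrite [e_lower _ _ _ _]mxE (negbTE nei) andbF mulr0.
rewrite mulrC mxE (bigD1 (snd_ix p)) //= big1 ?addr0 => [|i nei]; last first.
  by rewrite [e_lower _ _ _ _]mxE (negbTE nei) mulr0.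
by rewrite [e_lower _ _ _ _]mxE !eqxx mulr1.
Qed.

Lemma phi_e_lower (K : fieldType) n (p : upair n) :
  phi (e_lower _ p) = \sum_k phi_coef K p k *: e_diag _ k.
Proof.
have tr0 : \tr (phi (e_lower (polyu K n) p)) = 0.
  rewrite /phi /proj_h mxtrace_diag.
  under eq_bigr do rewrite mxE.
  rewrite -/(\tr _) /Ad mxtrace_mulC mulmxA mulVmx ?Umx_unit // mul1mx.
  rewrite /mxtrace big1 // => i _; rewrite mxE.
  case: eqP => // ->; case: eqP => //= eq_ix.
  by have := valP p; rewrite /fst_ix /snd_ix in eq_ix *; rewrite /= eq_ix ltnn.
have phi0 i j : i != j -> phi (e_lower (polyu K n) p) i j = 0.
  by move=> neij; rewrite !mxE (negbTE neij).
apply/matrixP=> i j; rewrite summxE.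
under eq_bigr do rewrite mxE e_diagE.
have nmax k : (ord_max == lift ord_max k :> 'I_n.+1) = false.
  by apply/negbTE; exact: neq_lift.
case: (eqVneq i j) => [<-|neij]; last first.
  rewrite phi0 // big1 // => k _.
  have -> : (i == lift ord_max k) && (j == lift ord_max k) = false.
    by apply/negbTE; apply: contra neij => /andP[/eqP-> /eqP->].
  have -> : (i == ord_max) && (j == ord_max) = false.
    by apply/negbTE; apply: contra neij => /andP[/eqP-> /eqP->].
  by rewrite subrr mulr0.
case: (unliftP ord_max i) => [k|] ->; last first.
  rewrite eqxx; under eq_bigr do rewrite nmax sub0r mulrN1.
  move: tr0; rewrite /mxtrace (bigD1 ord_max) //= => /eqP.
  rewrite addr_eq0 => /eqP ->; rewrite sumrN; congr (- _).
  rewrite (reindex_omap (lift ord_max) (unlift ord_max)) /=.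
    by apply: eq_bigl => k; rewrite liftK eq_sym nmax eqxx.
  by move=> k; case: unliftP => [m ->|->]; rewrite ?eqxx.
rewrite (bigD1 k) //= !eqxx eq_sym nmax subr0 mulr1 big1 ?addr0 // => m nemk.
by rewrite (inj_eq lift_inj) eq_sym (negbTE nemk) subrr mulr0.
Qed.

(* A maximal minor uses every column, hence only selects n distinct rows;
   reordering these rows changes the minor at most by a sign. *)
Definition phi_minor (K : fieldType) n (m : polyu K n) : Prop :=
  exists2 r : 'I_n -> upair n, injective r &
    m = \det (\matrix_(a, k) phi_coef K (r a) k).

Definition ideal_B (K : fieldType) n : polyu K n -> Prop :=
  ideal_gen (@phi_minor K n).

Section NerveComplex.

Variables (R : realType) (n : nat).

Local Notation V := 'rV[R]_n.+1.

Definition coord_sum (x : V) : R^o := \sum_i x 0 i.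

Definition coord_diff (p : upair n) (x : V) : R^o :=
  x 0 (fst_ix p) - x 0 (snd_ix p).

Fact coord_sum_linear : linear coord_sum.
Proof.
move=> a x y; rewrite /coord_sum scaler_sumr -big_split /=.
by apply: eq_bigr => i _; rewrite !mxE.
Qed.

HB.instance Definition _ :=
  GRing.isLinear.Build R V R^o *:%R coord_sum coord_sum_linear.

Fact coord_diff_linear p : linear (coord_diff p).
Proof.
by move=> a x y; rewrite /coord_diff !mxE scalerBr opprD addrACA.
Qed.

HB.instance Definition _ p :=
  GRing.isLinear.Build R V R^o *:%R (coord_diff p) (coord_diff_linear p).

Definition hR : {vspace V} := lker (linfun coord_sum).

Definition Omega (p : upair n) : {vspace V} :=
  (hR :&: lker (linfun (coord_diff p)))%VS.

Lemma mem_hR x : (x \in hR) = (\sum_i x 0 i == 0).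
Proof. by rewrite memv_ker lfunE. Qed.

Lemma mem_Omega p x :
  (x \in Omega p) = (x \in hR) && (x 0 (fst_ix p) == x 0 (snd_ix p)).
Proof.
by rewrite memv_cap; congr (_ && _); rewrite memv_ker lfunE; exact: (@subr_eq0 R).
Qed.

Definition arrangement (H : {vspace V}) : Prop := exists p, H = Omega p.

Definition flat (S : {set upair n}) : {vspace V} :=
  (hR :&: \bigcap_(p in S) Omega p)%VS.

(* The intersection poset without its minimum and its maximum. *)
Definition proper_flat (pi : {vspace V}) : Prop :=
  [/\ (exists S, pi = flat S), pi <> hR & pi <> flat [set: upair n]].

Definition nerve_facet (pi H : {vspace V}) : Prop :=
  arrangement H /\ (pi <= H)%VS.

Definition nerve_face (F : {vspace V} -> Prop) : Prop :=
  (forall H, ~ F H) \/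
  exists2 pi, proper_flat pi & forall H, F H -> nerve_facet pi H.

End NerveComplex.

Arguments Omega R {n} p.

Definition nonface_monomial (K : fieldType) (R : realType) n
    (m : polyu K n) : Prop :=
  exists2 S : {set upair n},
    ~ nerve_face (fun H => exists2 p, p \in S & H = Omega R p) &
    m = \prod_(p in S) u_var K p.

Definition ideal_Delta (K : fieldType) (R : realType) n : polyu K n -> Prop :=
  ideal_gen (@nonface_monomial K R n).

(* Main.v *)
Require Import Defs.
From mathcomp Require Import all_boot all_order all_algebra.
From mathcomp Require Import perm mpoly.
From mathcomp Require Import reals.

(** Write U = I + u, V = U^-1, and let r_ij = (V_ik U_kj)_k be the row of the
matrix of phi indexed by i < j, with one entry for each k in [0, n].  The
theorem comes from an invertible row operation.  For a fixed j, the identity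
U V = I and the triangularity of V give
<<
    sum_(i < j) U_ai r_ij = u_aj (e_a - e_j)        (a < j),
    sum_(a < j) V_ia u_aj (e_a - e_j) = r_ij        (i < j).
>>
Hence, over k[u], the rows of phi and the rows u_aj (e_a - e_j) span the same
module, and their maximal minors generate the same ideal
([ideal_B_edge_row]).  The new matrix is the incidence matrix of the complete
graph on [0, n], with the column of the last vertex deleted and the row of the
edge aj multiplied by u_aj.  The minor on n distinct edges is therefore the
product of their variables times a minor of the incidence matrix, which is a
constant.

This constant vanishes when the n edges do not connect [0, n], because the
indicator function of a union of components is in the kernel
([det_incidence_disconnected]).  Conversely, a function that is constant along
the edges of a connected graph and zero at the last vertex is zero; so the
incidence matrix of a connected graph has rank n over k, and some n of its
edges give a minor that is a nonzero constant ([connected_minor]).  The ideal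
of minors is thus generated by the products of variables over connected edge
sets.

On the other side, a set S of hyperplanes x_i = x_j is a face of the nerve
exactly when their intersection is nonzero, and the points of this
intersection are the functions of sum zero that are constant on the components
of S; so the faces are the disconnected edge sets ([nerve_faceP]). *)

Set Implicit Arguments.
Unset Strict Implicit.
Unset Printing Implicit Defensive.

Import GRing.Theory Num.Theory.
Local Open Scope ring_scope.

(** * Ideals and maximal minors *)

Lemma ideal_gen_mem (A : comNzRingType) (S : A -> Prop) x :
  S x -> ideal_gen S x.
Proof.
move=> Sx; exists [:: (1, x)]; split; last by rewrite big_seq1 mul1r.
by move=> p; rewrite inE => /eqP ->.
Qed.

Lemma ideal_gen0 (A : comNzRingType) (S : A -> Prop) : ideal_gen S 0.
Proof. by exists [::]; split=> //; rewrite big_nil. Qed.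

Lemma ideal_genD (A : comNzRingType) (S : A -> Prop) x y :
  ideal_gen S x -> ideal_gen S y -> ideal_gen S (x + y).
Proof.
move=> [s [Ss ->]] [t [St ->]]; exists (s ++ t); split; last by rewrite big_cat.
by move=> p; rewrite mem_cat => /orP[/Ss|/St].
Qed.

Lemma ideal_genM (A : comNzRingType) (S : A -> Prop) a x :
  ideal_gen S x -> ideal_gen S (a * x).
Proof.
move=> [s [Ss ->]]; exists [seq (a * p.1, p.2) | p <- s]; split.
  by move=> _ /mapP[p /Ss Sp ->].
by rewrite big_map mulr_sumr; apply: eq_bigr => p _; rewrite mulrA.
Qed.

Lemma ideal_gen_sum (A : comNzRingType) (S : A -> Prop) (I : eqType)
    (r : seq I) (F : I -> A) :
  (forall i, i \in r -> ideal_gen S (F i)) -> ideal_gen S (\sum_(i <- r) F i).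
Proof.
move=> SF; rewrite big_seq; apply: (big_ind (ideal_gen S)) => //.
  exact: ideal_gen0.
exact: ideal_genD.
Qed.

Lemma ideal_gen_trans (A : comNzRingType) (S T : A -> Prop) x :
  (forall y, S y -> ideal_gen T y) -> ideal_gen S x -> ideal_gen T x.
Proof.
move=> ST [s [Ss ->]]; apply: ideal_gen_sum => p /Ss /ST.
exact: ideal_genM.
Qed.

Definition max_minor (A : comNzRingType) (Q : finType) n
    (B : Q -> 'I_n -> A) (x : A) : Prop :=
  exists2 r : 'I_n -> Q, injective r & x = \det (\matrix_(a, k) B (r a) k).

(** The determinant is multilinear in its rows, so a minor of B expands into
minors of B' on rows chosen with possible repetitions, and a repeated row makes
such a minor vanish. *)
Lemma max_minor_row_comb (A : comNzRingType) (P Q : finType) n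
    (B : P -> 'I_n -> A) (B' : Q -> 'I_n -> A) (c : P -> Q -> A) x :
    (forall p k, B p k = \sum_q c p q * B' q k) ->
  ideal_gen (max_minor B) x -> ideal_gen (max_minor B') x.
Proof.
move=> BE; apply: ideal_gen_trans => _ [r _ ->].
have -> : \det (\matrix_(a, k) B (r a) k) =
    \sum_(f : {ffun 'I_n -> Q}) (\prod_a c (r a) (f a)) *
      \det (\matrix_(a, k) B' (f a) k).
  transitivity (\sum_(f : {ffun 'I_n -> Q}) \sum_(s : 'S_n) (-1) ^+ s *
      \prod_a (c (r a) (f a) * B' (f a) (s a))).
    rewrite exchange_big; apply: eq_bigr => /= s _; rewrite -big_distrr /=.
    congr (_ * _).
    rewrite -(bigA_distr_bigA (fun a q => c (r a) q * B' q (s a))) /=.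
    by apply: eq_bigr => a _; rewrite mxE BE.
  apply: eq_bigr => f _; rewrite big_distrr /=; apply: eq_bigr => s _.
  rewrite mulrCA big_split /=; congr (_ * (_ * _)).
  by apply: eq_bigr => a _; rewrite mxE.
apply: ideal_gen_sum => f _; apply: ideal_genM.
have [/injectiveP inj_f|/injectivePn[a [b neq_ab eq_f]]] :=
  boolP (injectiveb f).
  by apply: ideal_gen_mem; exists f.
rewrite (determinant_alternate neq_ab); first exact: ideal_gen0.
by move=> k; rewrite !mxE eq_f.
Qed.

(** * Reduction to the weighted incidence matrix *)

Lemma ltn_upair n (p : upair n) : (fst_ix p < snd_ix p)%N.
Proof. exact: (valP p). Qed.

Lemma sum_upair_snd (A : nmodType) n (j : 'I_n.+1) (F : 'I_n.+1 -> A) :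
  \sum_(p : upair n | snd_ix p == j) F (fst_ix p)
  = \sum_(i < n.+1 | (i < j)%N) F i.
Proof.
rewrite [RHS](reindex_omap (@fst_ix n) (fun i => insub (i, j))) /=.
  apply: eq_bigl => p; apply/eqP/andP => [<-|[ltpj /eqP]].
    rewrite ltn_upair; split=> //; apply/eqP.
    by rewrite -[RHS](valK p) /fst_ix /snd_ix -surjective_pairing.
  by rewrite insubT /= => -[<-].
by move=> i lt_ij; rewrite insubT.
Qed.

Section TriangularInverse.

Variables (A : comNzRingType) (n : nat) (U V : 'M[A]_n.+1).
Hypotheses (UV : U *m V = 1%:M) (VU : V *m U = 1%:M).
Hypotheses (U_low : forall i j : 'I_n.+1, (j < i)%N -> U i j = 0)
           (U_diag : forall i, U i i = 1).

(** Row i of U V = I expresses V i k through the entries V l k with l > i, hence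
the descending induction on i. *)
Lemma inv_unitri_low (i k : 'I_n.+1) : (k < i)%N -> V i k = 0.
Proof.
have [m] := ubnP (n - i); elim: m => // m IHm in i * => le_m lt_ki.
have /matrixP/(_ i k) := UV; rewrite !mxE (bigD1 i) //= U_diag mul1r.
have -> : (i == k) = false := gtn_eqF lt_ki.
rewrite big1 ?addr0 // => l neq_li.
have [lt_li|lt_il|/val_inj eq_li] := ltngtP l i.
- by rewrite U_low ?mul0r.
- rewrite IHm ?mulr0 //; last exact: ltn_trans lt_il.
  rewrite ltnS in le_m; apply: leq_trans le_m; rewrite ltn_sub2l //.
  by apply: leq_trans lt_il _; rewrite -ltnS.
- by rewrite eq_li eqxx in neq_li.
Qed.

Lemma inv_unitri_diag (i : 'I_n.+1) : V i i = 1.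
Proof.
have /matrixP/(_ i i) := UV; rewrite !mxE (bigD1 i) //= U_diag mul1r eqxx.
rewrite big1 ?addr0 // => l neq_li.
have [lt_li|lt_il|/val_inj eq_li] := ltngtP l i.
- by rewrite U_low ?mul0r.
- by rewrite inv_unitri_low ?mulr0.
- by rewrite eq_li eqxx in neq_li.
Qed.

(** Summing over all i would give U V = I times U k j, that is, the term in
[k == a]; among the indices i >= j, triangularity of U and V leaves only
i = j = k, which accounts for the term in [k == j]. *)
Lemma edge_row_comb (a j k : 'I_n.+1) : (a < j)%N ->
  \sum_(i < n.+1 | (i < j)%N) U a i * (V i k * U k j)
  = U a j * ((k == a)%:R - (k == j)%:R).
Proof.
move=> lt_aj.
have tot : \sum_(i < n.+1) U a i * (V i k * U k j) = (k == a)%:R * U k j.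
  have /matrixP/(_ a k) := UV; rewrite !mxE eq_sym => <-.
  by rewrite mulr_suml; apply: eq_bigr => i _; rewrite mulrA.
have tail : \sum_(i < n.+1 | ~~ (i < j)%N) U a i * (V i k * U k j)
    = U a j * (k == j)%:R.
  rewrite (bigD1 j) ?ltnn //= big1 ?addr0 => [|i /andP[]].
    have [->|neq_kj] := eqVneq k j.
      by rewrite inv_unitri_diag U_diag mulr1.
    have [lt_kj|lt_jk|/val_inj eq_kj] := ltngtP k j.
    - by rewrite (inv_unitri_low lt_kj) mul0r.
    - by rewrite (U_low lt_jk) !mulr0.
    - by rewrite eq_kj eqxx in neq_kj.
  rewrite -leqNgt leq_eqVlt => /orP[/eqP/val_inj ->|lt_ji _].
    by rewrite eqxx.
  have [le_kj|lt_jk] := leqP k j; last by rewrite (U_low lt_jk) !mulr0.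
  by rewrite inv_unitri_low ?mul0r ?mulr0 //; exact: leq_ltn_trans lt_ji.
rewrite (bigID (fun i : 'I_n.+1 => (i < j)%N)) /= tail in tot.
apply: (addIr (U a j * (k == j)%:R)); rewrite tot -mulrDr subrK mulrC.
by have [->|] := eqVneq k a; rewrite ?mulr0.
Qed.

(** The term in [k == a] gives the entry at once when k < j; for k = j, what is
left is minus the sum of V i a * U a j over a < j, which is V i j since the
entry (i, j) of V U is zero and U j j = 1. *)
Lemma low_row_comb (i j k : 'I_n.+1) : (i < j)%N ->
  \sum_(a < n.+1 | (a < j)%N) V i a * (U a j * ((k == a)%:R - (k == j)%:R))
  = V i k * U k j.
Proof.
move=> lt_ij; have [lt_kj|lt_jk|/val_inj ->] := ltngtP k j.
- rewrite (bigD1 k) //= eqxx big1 => [|a /andP[_ neq_ak]].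
    have -> : (k == j) = false := ltn_eqF lt_kj.
    by rewrite subr0 mulr1 addr0.
  have -> : (k == j) = false := ltn_eqF lt_kj.
  by rewrite eq_sym (negbTE neq_ak) subrr !mulr0.
- rewrite (U_low lt_jk) mulr0 big1 // => a lt_aj.
  have -> : (k == j) = false := gtn_eqF lt_jk.
  have -> : (k == a) = false := gtn_eqF (ltn_trans lt_aj lt_jk).
  by rewrite subrr !mulr0.
- have /matrixP/(_ i j) := VU; rewrite !mxE.
  have -> : (i == j) = false := ltn_eqF lt_ij.
  rewrite (bigID (fun a : 'I_n.+1 => (a < j)%N)) /=.
  rewrite [X in _ + X](bigD1 j) ?ltnn //=.
  rewrite [X in _ + (_ + X)]big1 => [|a /andP[]].
    rewrite addr0 => /eqP; rewrite addr_eq0 => /eqP sumE.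
    rewrite -[RHS]opprK -sumE -sumrN; apply: eq_bigr => a lt_aj.
    have -> : (j == a) = false := gtn_eqF lt_aj.
    by rewrite eqxx sub0r !mulrN1 mulrN.
  rewrite -leqNgt leq_eqVlt => /orP[/eqP/val_inj ->|lt_ja _].
    by rewrite eqxx.
  by rewrite U_low // mulr0.
Qed.

End TriangularInverse.

Lemma Umx_low (K : fieldType) n (i j : 'I_n.+1) :
  (j < i)%N -> Umx K n i j = 0.
Proof.
move=> lt_ji; rewrite !mxE insubF /=; last first.
  by apply/negbTE; rewrite -leqNgt ltnW.
have -> : (i == j) = false := gtn_eqF lt_ji.
by rewrite addr0.
Qed.

Lemma Umx_diag (K : fieldType) n (i : 'I_n.+1) : Umx K n i i = 1.
Proof. by rewrite !mxE insubF /= ?ltnn // addr0 eqxx. Qed.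

Lemma Umx_upair (K : fieldType) n (p : upair n) :
  Umx K n (fst_ix p) (snd_ix p) = u_var K p.
Proof.
rewrite !mxE -surjective_pairing valK.
have -> : (fst_ix p == snd_ix p) = false := ltn_eqF (ltn_upair p).
by rewrite add0r.
Qed.

(** Row of the edge p in the oriented incidence matrix of the complete graph on
the vertices 'I_n.+1, without the column of the vertex [ord_max]. *)
Definition incidence (A : pzRingType) n (p : upair n) (k : 'I_n) : A :=
  (lift ord_max k == fst_ix p)%:R - (lift ord_max k == snd_ix p)%:R.

Definition edge_row (K : fieldType) n (p : upair n) (k : 'I_n) : polyu K n :=
  u_var K p * incidence _ p k.

(** The row operations act separately on the pairs with a given second index;
this is the block matrix that repeats an initial block of W for each value of
that index. *)
Definition same_col (K : fieldType) n (W : 'M[polyu K n]_n.+1)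
    (p q : upair n) : polyu K n :=
  if snd_ix q == snd_ix p then W (fst_ix p) (fst_ix q) else 0.

Lemma sum_same_col (K : fieldType) n (W : 'M[polyu K n]_n.+1) (p : upair n)
    (F : 'I_n.+1 -> 'I_n.+1 -> polyu K n) :
  \sum_q same_col W p q * F (fst_ix q) (snd_ix q)
  = \sum_(i < n.+1 | (i < snd_ix p)%N) W (fst_ix p) i * F i (snd_ix p).
Proof.
rewrite -(sum_upair_snd _ (fun i => W (fst_ix p) i * F i (snd_ix p))).
rewrite [RHS]big_mkcond; apply: eq_bigr => q _.
by rewrite /same_col; case: eqP => [->|]; rewrite ?mul0r.
Qed.

Lemma edge_row_phi (K : fieldType) n (p : upair n) k :
  edge_row K p k = \sum_q same_col (Umx K n) p q * phi_coef K q k.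
Proof.
under eq_bigr do rewrite phi_coefE.
rewrite (sum_same_col _ _ (fun i j => invmx (Umx K n) i (lift ord_max k)
  * Umx K n (lift ord_max k) j)).
rewrite (edge_row_comb _ (@Umx_low K n) (@Umx_diag K n)) ?ltn_upair //.
  by rewrite Umx_upair.
by rewrite mulmxV ?Umx_unit.
Qed.

Lemma phi_edge_row (K : fieldType) n (p : upair n) k :
  phi_coef K p k = \sum_q same_col (invmx (Umx K n)) p q * edge_row K q k.
Proof.
rewrite phi_coefE.
under eq_bigr do rewrite /edge_row -Umx_upair.
rewrite (sum_same_col _ _ (fun i j => Umx K n i j
  * ((lift ord_max k == i)%:R - (lift ord_max k == j)%:R))).
rewrite (low_row_comb _ (@Umx_low K n)) ?ltn_upair //.
by rewrite mulVmx ?Umx_unit.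
Qed.

Lemma ideal_B_edge_row (K : fieldType) n (f : polyu K n) :
  ideal_B f <-> ideal_gen (max_minor (@edge_row K n)) f.
Proof.
split; first exact: max_minor_row_comb (@phi_edge_row K n).
exact: max_minor_row_comb (@edge_row_phi K n).
Qed.

Lemma det_edge_row (K : fieldType) n (r : 'I_n -> upair n) :
  \det (\matrix_(a, k) edge_row K (r a) k)
  = (\prod_a u_var K (r a)) * \det (\matrix_(a, k) incidence _ (r a) k).
Proof.
transitivity (\det (diag_mx (\row_a u_var K (r a))) *
    \det (\matrix_(a, k) incidence (polyu K n) (r a) k)).
  rewrite -det_mulmx; congr (\det _); apply/matrixP=> a k.
  by rewrite mul_diag_mx !mxE.
by rewrite det_diag; congr (_ * _); apply: eq_bigr => a _; rewrite mxE.
Qed.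

(** * Minors of the incidence matrix and connectedness *)

(** C is a union of connected components of the graph S; asking that it avoid
[ord_max] is no restriction, since C and its complement play the same role. *)
Definition disconnected n (S : {set upair n}) : Prop :=
  exists C : {set 'I_n.+1}, [/\ C != set0, ord_max \notin C &
    forall p, p \in S -> (fst_ix p \in C) = (snd_ix p \in C)].

(** The incidence matrix is the coboundary of functions on the vertices; the
deleted column amounts to working with functions that vanish at [ord_max]. *)
Lemma sum_incidence (A : pzRingType) n (p : upair n) (w : 'I_n.+1 -> A) :
  w ord_max = 0 ->
  \sum_k incidence A p k * w (lift ord_max k) = w (fst_ix p) - w (snd_ix p).
Proof.
move=> w0.
have sumE i : \sum_k (lift ord_max k == i)%:R * w (lift ord_max k) = w i.
  have [k ->|->] := unliftP ord_max i.
    rewrite (bigD1 k) //= eqxx mul1r big1 ?addr0 // => l neq_lk.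
    by rewrite (inj_eq lift_inj) (negbTE neq_lk) mul0r.
  rewrite w0 big1 // => k _.
  by rewrite eq_sym (negbTE (neq_lift _ _)) mul0r.
rewrite -!sumE -sumrB; apply: eq_bigr => k _.
by rewrite mulrBl.
Qed.

(** A square matrix over a commutative ring that kills a vector with an entry 1
has determinant zero, by multiplying with the adjugate; here the vector is the
indicator function of a union of components. *)
Lemma det_incidence_disconnected (A : comNzRingType) n (r : 'I_n -> upair n)
    (S : {set upair n}) :
    disconnected S -> (forall a, r a \in S) ->
  \det (\matrix_(a, k) incidence A (r a) k) = 0.
Proof.
move=> [C [/set0Pn[i iC] maxC SC]] rS; set M := (X in \det X).
pose v : 'cV[A]_n := \col_k (lift ord_max k \in C)%:R.
have Mv : M *m v = 0.
  apply/colP=> a; rewrite !mxE; under eq_bigr do rewrite !mxE.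
  rewrite (sum_incidence _ (w := fun j => (j \in C)%:R)) ?(negbTE maxC) //.
  by rewrite SC ?subrr.
have [k iE|iE] := unliftP ord_max i; last by rewrite iE (negbTE maxC) in iC.
have : (\det M)%:M *m v = 0 by rewrite -mul_adj_mx -mulmxA Mv mulmx0.
by move/colP/(_ k); rewrite mul_scalar_mx !mxE -iE iC mulr1.
Qed.

(** A spanning tree of S would do; finding n independent rows by a rank argument
avoids constructing one, and a nonzero determinant in the field K is enough to
divide by it. *)
Lemma connected_minor (K : fieldType) n (S : {set upair n}) :
    ~ disconnected S ->
  exists r : 'I_n -> upair n, [/\ injective r, forall a, r a \in S &
    \det (\matrix_(a, k) incidence K (r a) k) != 0].
Proof.
move=> conn.
(* The rows outside S are set to zero, so that independent rows lie in S. *)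
pose M : 'M[K]_(#|upair n|, n) :=
  \matrix_(i, k) ((enum_val i \in S)%:R * incidence K (enum_val i) k).
have full : row_full M.
  rewrite /row_full -mxrank_tr; apply: inj_row_free => v vM0.
  (* A kernel vector, extended by 0 at the last vertex, is constant along the
     edges of S; a nonzero level set of it would disconnect S. *)
  pose w i := if unlift ord_max i is Some k then v 0 k else 0.
  have w_lift k : w (lift ord_max k) = v 0 k by rewrite /w liftK.
  have w_max : w ord_max = 0 by rewrite /w unlift_none.
  apply/rowP=> k; rewrite mxE; apply/eqP; apply/negP => /negP v_k.
  apply: conn; exists [set i | w i == v 0 k]; split.
  - by apply/set0Pn; exists (lift ord_max k); rewrite inE w_lift.
  - by rewrite inE w_max eq_sym.
  - move=> p pS; rewrite !inE; congr (_ == _); apply/eqP; rewrite -subr_eq0.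
    rewrite -sum_incidence //.
    have /rowP/(_ (enum_rank p)) := vM0; rewrite !mxE => vMp.
    rewrite -[X in _ == X]vMp; apply/eqP/eq_bigr => l _.
    by rewrite !mxE enum_rankK pS mul1r w_lift mulrC.
pose f := fullrankfun full; have := fullrowsub_unit full.
rewrite -/f unitmxE unitfE => det_f.
have fS a : enum_val (f a) \in S.
  apply: contraNT det_f => fa; rewrite (expand_det_row _ a) big1 // => k _.
  by rewrite !mxE (negbTE fa) !mul0r.
exists (fun a => enum_val (f a)); split=> //.
  by move=> a b /enum_val_inj /fullrankfun_inj.
apply: contraNN det_f => /eqP det0; apply/eqP; rewrite -[RHS]det0.
by congr (\det _); apply/matrixP=> a k; rewrite !mxE fS mul1r.
Qed.

(** * Faces of the nerve complex *)

Section Nerve.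

Variables (R : realType) (n : nat).

Lemma mem_flat (S : {set upair n}) (x : 'rV[R]_n.+1) :
  reflect (x \in hR R n /\ forall p, p \in S -> x 0 (fst_ix p) = x 0 (snd_ix p))
          (x \in flat R S).
Proof.
rewrite memv_cap [X in _ && X]memvE.
apply: (iffP andP) => [[xh /subv_bigcapP xS]|[xh xS]].
  by split=> // p /xS; rewrite -memvE mem_Omega => /andP[_ /eqP].
split=> //; apply/subv_bigcapP=> p /xS xp.
by rewrite -memvE mem_Omega xh xp eqxx.
Qed.

(** A point of a proper flat that is not constant separates the vertices by a
level set of its coordinates; conversely the indicator function of a union of
components, corrected to have sum zero, is a nonzero point of the flat of S.
The assumption on n makes the edgeless graph disconnected. *)
Lemma nerve_faceP (S : {set upair n}) : (1 <= n)%N ->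
  nerve_face (fun H => exists2 p, p \in S & H = Omega R p) <-> disconnected S.
Proof.
move=> n_gt0; split.
  move=> [noH|[pi [[T piE] _ pi_neq] piF]].
    exists [set Ordinal (ltn0Sn n)]; split.
    - by apply/set0Pn; exists (Ordinal (ltn0Sn n)); rewrite inE.
    - by rewrite inE -val_eqE /= -lt0n.
    - by move=> p pS; case: (noH (Omega R p)); exists p.
  have [x xpi [p xp]] :
      exists2 x, x \in pi & exists p, x 0 (fst_ix p) != x 0 (snd_ix p).
    have /subvPn[x xpi xT] : ~~ (pi <= flat R [set: upair n])%VS.
      apply/negP=> le_pi; apply: pi_neq; apply/eqP; rewrite eqEsubv le_pi piE.
      apply/subvP=> x /mem_flat[xh xT]; apply/mem_flat; split=> // p _.
      exact: xT (in_setT p).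
    exists x => //; apply/existsP; apply: contraNT xT => /existsPn xT.
    apply/mem_flat; split=> [|p _].
      by move: xpi; rewrite piE => /mem_flat[].
    by apply/eqP; rewrite -[_ == _]negbK xT.
  (* One of two distinct coordinates differs from the last one, so its level set
     avoids the last vertex. *)
  pose i := if x 0 (fst_ix p) == x 0 ord_max then snd_ix p else fst_ix p.
  have xi : x 0 ord_max != x 0 i.
    by rewrite /i; case: ifP => [/eqP <- //|/negbT]; rewrite eq_sym.
  exists [set j | x 0 j == x 0 i]; split.
  - by apply/set0Pn; exists i; rewrite inE.
  - by rewrite inE.
  - move=> q qS; rewrite !inE.
    have [_ /subvP/(_ x xpi)] := piF _ (ex_intro2 _ _ q qS erefl).
    by rewrite mem_Omega => /andP[_ /eqP ->].
move=> [C [/set0Pn[i iC] maxC SC]].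
have [->|/set0Pn[p pS]] := eqVneq S set0.
  by left=> H [p]; rewrite inE.
right; exists (flat R S); last first.
  move=> H [q qS ->]; split; first by exists q.
  apply/subvP=> x /mem_flat[xh xS].
  by rewrite mem_Omega xh xS ?eqxx.
split; first by exists S.
  (* A point of sum zero off the hyperplane of p, so that the flat of S is not
     the whole space. *)
  pose x : 'rV[R]_n.+1 := delta_mx 0 (fst_ix p) - delta_mx 0 (snd_ix p).
  move=> eq_flat; have : x \in flat R S.
    rewrite eq_flat mem_hR; apply/eqP.
    under eq_bigr do rewrite !mxE eqxx /=.
    by rewrite sumrB -!natr_sum -!big_mkcond !big_pred1_eq subrr.
  move=> /mem_flat[_ /(_ p pS)]; rewrite !mxE !eqxx /=.
  have neq_p : (fst_ix p == snd_ix p) = false := ltn_eqF (ltn_upair p).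
  rewrite [snd_ix p == _]eq_sym neq_p subr0 sub0r => /eqP.
  by rewrite -subr_eq0 opprK -natrD pnatr_eq0.
pose x : 'rV[R]_n.+1 := \row_j ((j \in C)%:R - #|C|%:R / n.+1%:R).
have : x \in flat R S.
  apply/mem_flat; split=> [|q /SC qC]; last by rewrite !mxE qC.
  rewrite mem_hR; under eq_bigr do rewrite mxE.
  rewrite sumrB sumr_const card_ord -natr_sum -big_mkcond sum1_card.
  by rewrite -[X in _ - X]mulr_natr divfK ?subrr // pnatr_eq0.
move=> xS eq_flat; move: xS; rewrite eq_flat => /mem_flat[_ xT].
have lt_i : (i < @ord_max n)%N.
  rewrite ltn_neqAle -ltnS ltn_ord andbT.
  by apply: contraNneq maxC => /val_inj <-.
have := xT (exist _ (i, ord_max) lt_i) (in_setT _).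
rewrite !mxE /fst_ix /snd_ix /= iC (negbTE maxC) => /addIr /eqP.
by rewrite oner_eq0.
Qed.

End Nerve.

(** * Equality of the two ideals *)

Lemma det_incidence_polyC (K : fieldType) n (r : 'I_n -> upair n) :
  \det (\matrix_(a, k) incidence (polyu K n) (r a) k)
  = (\det (\matrix_(a, k) incidence K (r a) k))%:MP.
Proof.
rewrite -det_map_mx; congr (\det _); apply/matrixP=> a k.
by rewrite !mxE rmorphB !rmorph_nat.
Qed.

Theorem theorem5p4 (K : fieldType) (R : realType) (n : nat) (hn : (1 <= n)%N)
    (f : polyu K n) :
  ideal_Delta R f <-> ideal_B f.
Proof.
rewrite ideal_B_edge_row; split; apply: ideal_gen_trans => y.
  move=> [S S_nonface ->].
  have [|r [inj_r rS det_r]] := @connected_minor K n S.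
    by move=> /(nerve_faceP R _ hn).
  have rS_sub : [set r a | a : 'I_n] \subset S.
    by apply/subsetP=> _ /imsetP[a _ ->].
  have -> : \prod_(p in S) u_var K p =
      (\prod_(p in S :\: [set r a | a : 'I_n]) u_var K p) *
      ((\det (\matrix_(a, k) incidence K (r a) k))^-1)%:MP *
      \det (\matrix_(a, k) edge_row K (r a) k).
    rewrite det_edge_row det_incidence_polyC mulrACA -mpolyCM mulVf // mulr1.
    rewrite (big_setID [set r a | a : 'I_n]) /= (setIidPr rS_sub) mulrC.
    by rewrite big_imset // => a b _ _; apply: inj_r.
  by apply: ideal_genM; apply: ideal_gen_mem; exists r.
move=> [r inj_r ->]; rewrite det_edge_row.
have [->|det_r] :=
  eqVneq (\det (\matrix_(a, k) incidence (polyu K n) (r a) k)) 0.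
  by rewrite mulr0; exact: ideal_gen0.
rewrite mulrC; apply: ideal_genM; apply: ideal_gen_mem.
exists [set r a | a : 'I_n].
  move=> /(nerve_faceP R _ hn) disc; case/eqP: det_r.
  by apply: det_incidence_disconnected disc _ => a; apply: imset_f.
by rewrite big_imset //= => a b _ _; apply: inj_r.
Qed.
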